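(* Let $R$ be a commutative ring with identity and let $\{a_n\}_{n\ge 0}$ be a sequence of elements of $R$. For every nonnegative integer $k$, the $k$th power of the infinite semicirculant matrix $A=[a_0,a_1,a_2,\ldots]$ is $$A^k=[\boldsymbol{a}_0^{(k)},\boldsymbol{a}_1^{(k)},\boldsymbol{a}_2^{(k)},\ldots],$$ where $\boldsymbol{a}_0^{(k)}=a_0^k\binom{k}{0}$ and, for $m\ge 1$, $$\boldsymbol{a}_m^{(k)}=\sum_{p=1}^{m}L(m,p)\,a_0^{k-p}\binom{k}{p}.$$
   Context: $\mathbb{N}$ denotes the nonnegative integers. For a sequence $\{c_n\}_{n\ge0}$ in $R$, the infinite semicirculant matrix $[c_0,c_1,c_2,\ldots]$ is the upper triangular Toeplitz matrix with rows and columns indexed by the positive integers whose $(i,j)$ entry is $c_{j-i}$ if $j\ge i$ and $0$ if $j<i$. (Products of such matrices are well defined, each entry being a finite sum.) For integers $1\le p\le m$, $\Delta(m,p)$ is the set of all $(k_1,\ldots,k_m)\in\mathbb{N}^m$ with $k_1+\cdots+k_m=p$ and $k_1+2k_2+\cdots+mk_m=m$, and $$L(m,p)=\sum_{(k_1,\ldots,k_m)\in\Delta(m,p)}\binom{p}{k_1,\ldots,k_m}a_1^{k_1}\cdots a_m^{k_m},$$ where $\binom{p}{k_1,\ldots,k_m}=\frac{p!}{k_1!\cdots k_m!}$ is the multinomial coefficient. Convention: for any $a\in R$ and nonnegative integers $k\le p$, the expression $a^{k-p}\binom{k}{p}$ means $\delta_{k,p}$, i.e. $1$ if $k=p$ and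 $0$ if $k<p$ (even when $a$ is not a unit). Also $a^0=1$ for all $a\in R$. *)

(* Defs.v *)
From mathcomp Require Import all_boot all_algebra.
From mathcomp Require Import boolp classical_sets fsbigop.

Set Implicit Arguments.
Unset Strict Implicit.
Unset Printing Implicit Defensive.

Import GRing.Theory.
Local Open Scope ring_scope.

(* Indices are shifted by one, as for 'M_n: [M i j] is the entry in row [i + 1]
   and column [j + 1] of a matrix indexed by the positive integers. *)
Definition infmx (R : Type) : Type := nat -> nat -> R.

Definition infmx1 (R : comPzRingType) : infmx R := fun i j => (i == j)%:R.

(* The sum ranges over the finitely many [l] whose term is nonzero; by
   convention it is 0 if there are infinitely many such [l], which cannot happen
   when [A] and [B] are upper triangular (see [infmx_mul_upper]). *)
Definition infmx_mul (R : comPzRingType) (A B : infmx R) : infmx R :=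
  fun i j => \sum_(l \in [set: nat]%classic) (A i l * B l j).

Definition infmx_exp (R : comPzRingType) (A : infmx R) (k : nat) : infmx R :=
  iter k (infmx_mul A) (infmx1 R).

Definition semicirculant (R : comPzRingType) (c : nat -> R) : infmx R :=
  fun i j => if (i <= j)%N then c (j - i)%N else 0.

(* [k i] is the exponent k_(i+1). Bounding the entries by [p] loses nothing,
   since they are natural numbers with sum [p]. *)
Definition Delta (m p : nat) : {set {ffun 'I_m -> 'I_p.+1}} :=
  [set k : {ffun 'I_m -> 'I_p.+1} |
    (\sum_(i < m) k i == p)%N && (\sum_(i < m) i.+1 * k i == m)%N].

(* The division is exact when the [k i] have sum [p]. *)
Definition multinomial (m p : nat) (k : 'I_m -> nat) : nat :=
  (p`! %/ \prod_(i < m) (k i)`!)%N.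

Definition L (R : comPzRingType) (a : nat -> R) (m p : nat) : R :=
  \sum_(k in Delta m p)
    (multinomial p (fun i => k i))%:R * \prod_(i < m) a i.+1 ^+ k i.

(* The expression a ^ (k - p) * binomial k p, which stands for the Kronecker
   delta of k and p when k <= p, even if a is not a unit. *)
Definition expB_bin (R : comPzRingType) (a : R) (k p : nat) : R :=
  if (k <= p)%N then (k == p)%:R else a ^+ (k - p) * 'C(k, p)%:R.

Lemma infmx_mul_upper (R : comPzRingType) (A B : infmx R) (i j : nat) :
    (forall i j, (j < i)%N -> A i j = 0) ->
    (forall i j, (j < i)%N -> B i j = 0) ->
  infmx_mul A B i j = \sum_(i <= l < j.+1) A i l * B l j.
Proof.
move=> upA upB; rewrite /infmx_mul (@fsbigE _ _ _ _ _ (index_iota i j.+1)).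
- by apply: eq_bigl => l; rewrite in_setT.
- exact: iota_uniq.
- by [].
- move=> l _; rewrite mem_index_iota ltnS negb_and -!ltnNge => /orP[/upA->|/upB->].
    by rewrite mul0r.
  by rewrite mulr0.
Qed.

(* Main.v *)
(** Semicirculant matrices multiply like power series, so the entry on the
    m-th diagonal of A^k is the coefficient of X^m in (a_0 + b)^k, where b is the
    sum of the a_i X^i for 1 <= i <= m. The binomial theorem turns this into the
    sum over p of a_0^(k-p) binomial(k, p) times the coefficient of X^m in b^p,
    which is L(m, p) by the multinomial theorem. *)

From HB Require Import structures.
Require Import Defs.
From mathcomp Require Import all_boot all_algebra.
From mathcomp Require Import boolp zify.

Set Implicit Arguments.
Unset Strict Implicit.
Unset Printing Implicit Defensive.

Import GRing.Theory.

Local Open Scope ring_scope.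

(** Induction on the number of factors: [(k i + s)!] is a binomial coefficient times
    [(k i)! * s!]. *)
Lemma dvdn_prod_fact m (k : 'I_m -> nat) :
  (\prod_(i < m) (k i)`! %| (\sum_(i < m) k i)`!)%N.
Proof.
elim/big_rec2: _ => // i s x _ xs; rewrite -(bin_fact (leq_addr s (k i))).
by rewrite addKn dvdn_mull // dvdn_mul.
Qed.

Lemma prod_fact_gt0 m (k : 'I_m -> nat) : (0 < \prod_(i < m) (k i)`!)%N.
Proof. by apply: prodn_gt0 => i; apply: fact_gt0. Qed.

Lemma multinomialK m p (k : 'I_m -> nat) : (\sum_(i < m) k i = p)%N ->
  (multinomial p k * \prod_(i < m) (k i)`! = p`!)%N.
Proof. by move=> <-; rewrite divnK // dvdn_prod_fact. Qed.

Lemma eq_multinomial m p (k k' : 'I_m -> nat) :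
  k =1 k' -> multinomial p k = multinomial p k'.
Proof. by move=> /funext ->. Qed.

Lemma sum_nat_delta m (i : 'I_m) : (\sum_(j < m) (j == i) = 1)%N.
Proof. by rewrite (bigD1 i) //= eqxx big1 // => j /negPf->. Qed.

Lemma sumnD_delta m (k : 'I_m -> nat) i :
  (\sum_(j < m) (k j + (j == i)) = (\sum_(j < m) k j).+1)%N.
Proof. by rewrite big_split /= sum_nat_delta addn1. Qed.

Lemma sumnB_delta m (k : 'I_m -> nat) i : (0 < k i)%N ->
  ((\sum_(j < m) (k j - (j == i))).+1 = \sum_(j < m) k j)%N.
Proof.
move=> ki_gt0; rewrite -(sumnD_delta _ i); apply: eq_bigr => j _.
by case: eqVneq => [->|_]; rewrite ?subnK ?subn0 ?addn0.
Qed.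

(** Pascal's rule for multinomials: words with [k j] letters [j] are counted by their first letter
    [i]. The guard [0 < k i] excludes the terms where truncated subtraction would leave [k]
    unchanged. *)
Lemma multinomialS m p (k : 'I_m -> nat) : (\sum_(i < m) k i = p.+1)%N ->
  multinomial p.+1 k =
  (\sum_(i < m | 0 < k i) multinomial p (fun j => k j - (j == i)))%N.
Proof.
move=> sk; apply/eqP; rewrite -(eqn_pmul2r (prod_fact_gt0 k)) multinomialK //.
rewrite big_distrl /=.
(* Multiplied by the product of the (k j)!, the term of index i is k_i p!. *)
rewrite (eq_bigr (fun i => k i * p`!)%N); last first.
  move=> i ki_gt0.
  have <- : (multinomial p (fun j => k j - (j == i)) *
      \prod_(j < m) (k j - (j == i))`! = p`!)%N.
    by apply/multinomialK/eqP; rewrite -eqSS sumnB_delta // sk.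
  rewrite mulnCA; congr (_ * _)%N.
  rewrite (bigD1 i) //= [in RHS](bigD1 i) //= eqxx mulnA.
  rewrite subn1 -{1}(prednK ki_gt0) factS prednK //; congr (_ * _)%N.
  by apply: eq_bigr => j /negPf->; rewrite subn0.
rewrite -big_distrl /= factS -sk; apply/eqP; rewrite [in RHS]big_mkcond.
congr (_ * _)%N.
by apply: eq_bigr => i _; case: (k i).
Qed.

(* The bound [B] on the exponents is decoupled from [p], so that it stays fixed
   in the induction on [p]. *)
Lemma multinomial_theorem (S : comPzSemiRingType) m (x : 'I_m -> S) B p :
    (p <= B)%N ->
  (\sum_(i < m) x i) ^+ p =
  \sum_(k : {ffun 'I_m -> 'I_B.+1} | (\sum_(i < m) k i == p)%N)
    (multinomial p (fun i => k i))%:R * \prod_(i < m) x i ^+ k i.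
Proof.
elim: p => [|p IHp] pB.
  rewrite expr0 (big_pred1 [ffun=> ord0]) => [|k].
    by rewrite /multinomial !big1 ?divn1 ?mulr1 // => i _; rewrite ffunE.
  rewrite /= sum_nat_eq0; apply/forall_inP/eqP => [k0|-> i _]; last first.
    by rewrite ffunE.
  by apply/ffunP => i; rewrite ffunE; apply/val_inj/eqP/k0.
rewrite exprS IHp 1?ltnW // mulr_suml.
under [RHS]eq_bigr => k /eqP sk do rewrite multinomialS // natr_sum mulr_suml.
rewrite (exchange_big_dep xpredT) //=; apply: eq_bigr => i _; rewrite mulr_sumr.
(* With [i] fixed, lowering and raising the exponent of [x i] match the tuples of sum [p.+1] having
   [0 < k i] with those of sum [p]. [inord] is harmless: a raised exponent is at most
   [p.+1 <= B]. *)
pose dec (k : {ffun 'I_m -> 'I_B.+1}) : {ffun 'I_m -> 'I_B.+1} :=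
  [ffun j => inord (k j - (j == i))].
pose inc (k : {ffun 'I_m -> 'I_B.+1}) : {ffun 'I_m -> 'I_B.+1} :=
  [ffun j => inord (k j + (j == i))].
have decE (k : {ffun 'I_m -> 'I_B.+1}) (j : 'I_m) :
    dec k j = (k j - (j == i))%N :> nat.
  by rewrite ffunE inordK // ltnS; have := ltn_ord (k j); lia.
have incE (k : {ffun 'I_m -> 'I_B.+1}) : (\sum_(j < m) k j == p)%N ->
    forall j : 'I_m, inc k j = (k j + (j == i))%N :> nat.
  move=> /eqP sk j; rewrite ffunE inordK // ltnS.
  have : (k j <= p)%N by rewrite -sk (bigD1 j) //= leq_addr.
  by case: eqP; lia.
rewrite (reindex_onto dec inc) => [|k sk]; last first.
  by apply/ffunP => j; apply/val_inj; rewrite /= decE incE // addnK.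
have sum_dec (k : {ffun 'I_m -> 'I_B.+1}) : (0 < k i)%N ->
    ((\sum_(j < m) dec k j).+1 = \sum_(j < m) k j)%N.
  by move=> ki; under eq_bigr do rewrite decE; apply: sumnB_delta.
have decK (k : {ffun 'I_m -> 'I_B.+1}) : (0 < k i)%N ->
    (\sum_(j < m) k j == p.+1)%N -> inc (dec k) = k.
  move=> ki sk; apply/ffunP => j; apply/val_inj.
  rewrite /= incE ?decE -1?eqSS ?sum_dec //.
  by case: eqVneq => [->|_]; rewrite ?subnK ?subn0 ?addn0.
(* Reindexing leaves the condition [inc (dec k) = k]. It forces [0 < k i], since [inc] always yields
   a positive exponent at [i]. *)
apply: eq_big => [k|k /andP[sk /eqP kK]].
  apply/andP/andP => [[sk /eqP kK]|[sk ki]].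
    have ki : (0 < k i)%N by rewrite -kK incE // eqxx addn1.
    by rewrite -sum_dec ?eqSS.
  by rewrite -eqSS sum_dec // sk decK.
have ki : (0 < k i)%N by rewrite -kK incE // eqxx addn1.
under eq_multinomial do rewrite decE.
rewrite mulrCA; congr (_ * _).
rewrite (bigD1 i) // [in RHS](bigD1 i) //= decE eqxx mulrA -exprS subn1 prednK //.
by congr (_ * _); apply: eq_bigr => j /negPf ji; rewrite decE ji subn0.
Qed.

Definition tail_poly (R : comNzRingType) (a : nat -> R) m : {poly R} :=
  \sum_(i < m) a i.+1 *: 'X^(i.+1).

(** The multinomial theorem with [B = p] supplies the first condition of [Delta]. The monomial of
    [k] has degree equal to the sum of the [i.+1 * k i], so taking the coefficient of ['X^m]
    supplies the second. *)
Lemma coef_tail_exp (R : comNzRingType) (a : nat -> R) m p :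
  (tail_poly a m ^+ p)`_m = L a m p.
Proof.
rewrite (multinomial_theorem _ (leqnn p)) coef_sum /L big_mkcond.
rewrite [RHS]big_mkcond; apply: eq_bigr => k _; rewrite inE.
case: ifP => //= _.
under eq_bigr do rewrite exprZn -exprM.
rewrite scaler_prod prodrXr -scalerAr coefZ [_%:R * 'X^_]mulr_natl coefMn.
rewrite coefXn eq_sym; case: eqP => _; first by rewrite mulrC.
by rewrite mul0rn mulr0.
Qed.

Lemma L_eq0 (R : comPzRingType) (a : nat -> R) m p : (m < p)%N -> L a m p = 0.
Proof.
move=> mp; rewrite /L big_pred0 // => k; rewrite inE.
apply/negP => /andP[/eqP sk /eqP wk].
have : (p <= m)%N.
  by rewrite -sk -[leqRHS]wk; apply: leq_sum => i _; rewrite mulSn leq_addr.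
by rewrite leqNgt mp.
Qed.

Lemma L0 (R : comPzRingType) (a : nat -> R) m : (0 < m)%N -> L a m 0 = 0.
Proof.
move=> m0; rewrite /L big_pred0 // => k; rewrite inE.
apply/negP => /andP[_ /eqP wk]; move: m0; rewrite -wk big1 // => i _.
by rewrite [k i]ord1 muln0.
Qed.

(** The convention agrees with truncated subtraction: the binomial vanishes for [k < p], and both
    factors are 1 for [k = p]. *)
Lemma expB_binE (R : comPzRingType) (a : R) k p :
  expB_bin a k p = a ^+ (k - p) * 'C(k, p)%:R.
Proof.
rewrite /expB_bin; case: ltngtP => // [kp|->].
  by rewrite bin_small // mulr0.
by rewrite subnn binn mulr1.
Qed.

Lemma semicirculant_upper (R : comPzRingType) (c : nat -> R) i j :
  (j < i)%N -> semicirculant c i j = 0.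
Proof. by move=> ji; rewrite /semicirculant leqNgt ji. Qed.

Definition seq_mul (R : comPzRingType) (c d : nat -> R) (n : nat) : R :=
  \sum_(l < n.+1) c l * d (n - l)%N.

(** Only [i <= l <= j] contributes to entry [(i, j)]; shifting [l] by [i] gives the Cauchy product
    at [j - i]. *)
Lemma semicirculant_mul (R : comPzRingType) (c d : nat -> R) :
  infmx_mul (semicirculant c) (semicirculant d) = semicirculant (seq_mul c d).
Proof.
apply/funext => i; apply/funext => j.
rewrite infmx_mul_upper; try exact: semicirculant_upper.
rewrite {3}/semicirculant; case: leqP => ij; last by rewrite big_geq.
rewrite -{1}[i]add0n big_addn subSn // big_mkord; apply: eq_bigr => l _.
rewrite /semicirculant leq_addl addnK ifT; last by have := ltn_ord l; lia.
by congr (_ * d _); lia.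
Qed.

Definition seq_exp (R : comPzRingType) (c : nat -> R) (k : nat) : nat -> R :=
  iter k (seq_mul c) (fun n => (n == 0%N)%:R).

Lemma semicirculant_exp (R : comPzRingType) (c : nat -> R) k :
  infmx_exp (semicirculant c) k = semicirculant (seq_exp c k).
Proof.
elim: k => [|k IHk]; last first.
  by rewrite /infmx_exp /= -/(infmx_exp _ k) IHk semicirculant_mul.
apply/funext => i; apply/funext => j; rewrite /infmx_exp /= /infmx1.
by rewrite /semicirculant subn_eq0; case: ltngtP.
Qed.

(** The truncation degree [n] is independent of [m] because the induction on [k] needs all
    coefficients up to [m] of powers of one polynomial. *)
Lemma seq_exp_coef (R : comNzRingType) (a : nat -> R) k m n : (m <= n)%N ->
  seq_exp a k m = (((a 0%N)%:P + tail_poly a n) ^+ k)`_m.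
Proof.
elim: k m => [|k IHk] m mn; first by rewrite expr0 coef1.
rewrite exprS coefM /seq_exp /= -/(seq_exp a k); apply: eq_bigr => l _.
rewrite IHk; last exact: leq_trans (leq_subr _ _) mn.
congr (_ * _); rewrite coefD coefC coef_sumMXn.
have ln : (l <= n)%N by have := ltn_ord l; lia.
case: (l : nat) ln => [_|l' ln]; first by rewrite big_pred0 ?addr0.
by rewrite (big_pred1 (Ordinal ln)) ?add0r // => i; rewrite eqSS.
Qed.

Lemma seq_expE (R : comNzRingType) (a : nat -> R) k m :
  seq_exp a k m =
  if m == 0%N then a 0%N ^+ k * 'C(k, 0)%:R
  else \sum_(1 <= p < m.+1) L a m p * expB_bin (a 0%N) k p.
Proof.
rewrite (seq_exp_coef _ _ (leqnn m)); case: eqVneq => [->|m_neq0].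
  by rewrite /tail_poly big_ord0 addr0 -polyC_exp coefC bin0 mulr1.
pose F p := L a m p * expB_bin (a 0%N) k p.
rewrite exprDn coef_sum.
transitivity (\sum_(p < k.+1) F p).
  apply: eq_bigr => p _; rewrite coefMn -polyC_exp mulrC coefMC coef_tail_exp.
  by rewrite /F expB_binE mulrA mulr_natr.
(* The binomial theorem sums over [p <= k], the goal over [1 <= p <= m]; both are extended by zeros
   to [maxn k m]. *)
have sumF n N : (forall p, (n < p)%N -> F p = 0) -> (n <= N)%N ->
    \sum_(0 <= p < n.+1) F p = \sum_(0 <= p < N.+1) F p.
  move=> F0 nN; rewrite (@big_nat_widen _ _ _ _ _ N.+1) // big_mkcondr /=.
  by apply: eq_bigr => p _; case: ltnP => // /F0.
rewrite -(big_mkord xpredT F) (sumF _ (maxn k m)) ?leq_maxl //; last first.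
  by move=> p kp; rewrite /F expB_binE bin_small // !mulr0.
rewrite -(sumF m) ?leq_maxr //; last by move=> p mp; rewrite /F L_eq0 ?mul0r.
(* The term [p = 0] drops out because [m] is positive. *)
by rewrite big_ltn // {1}/F L0 ?lt0n // mul0r add0r.
Qed.

Theorem theorem3p1 (R : comPzRingType) (a : nat -> R) (k : nat) :
  infmx_exp (semicirculant a) k =
  semicirculant (fun m : nat =>
    if m == 0%N then a 0%N ^+ k * 'C(k, 0)%:R
    else \sum_(1 <= p < m.+1) L a m p * expB_bin (a 0%N) k p).
Proof.
rewrite semicirculant_exp; congr semicirculant; apply/funext => m.
(* [R] may be the zero ring, over which [{poly R}] is not defined. *)
have [R0|R_neq0] := eqVneq (1 : R) 0.
  by rewrite -[LHS]mul1r -[RHS]mul1r R0 !mul0r.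
pose R' : comNzRingType :=
  HB.pack (GRing.ComPzRing.sort R) (GRing.PzSemiRing_isNonZero.Build R R_neq0).
exact: (@seq_expE R').
Qed.
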